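(* The set $\{h(E(S)) : S\in\mathbf{G}\}$ is uncountable.
   Context: Let $\mathbf{G}$ be the set of all finite or infinite (strictly) increasing sequences of positive integers beginning with $1$; a sequence is identified with the set of its terms. For $S\in\mathbf{G}$, a positive integer $N$ is called an exponentially $S$-number, written $N\in E(S)$, if all exponents in its prime power factorization belong to $S$ (so $1\in E(S)$ vacuously). For every $S\in\mathbf{G}$, $h(E(S))$ denotes the natural density of $E(S)$, i.e. $h(E(S))=\lim_{x\to\infty}\frac1x\#\{i\le x: i\in E(S)\}$. It is known from earlier work that this density exists, lies in $[\frac{6}{\pi^2},1]$, and equals $$h(E(S))=\prod_{p}\Bigl(1+\sum_{i\ge2}\frac{u(i)-u(i-1)}{p^i}\Bigr),$$ where $p$ runs over all primes and $u$ is the characteristic function of $S$ ($u(n)=1$ if $n\in S$, $u(n)=0$ otherwise). *)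

(* Defs.v *)
From HB Require Import structures.
From mathcomp Require Import all_boot all_order all_algebra.
From mathcomp Require Import finmap.
From mathcomp Require Import all_classical all_reals all_analysis.
Set Implicit Arguments.
Unset Strict Implicit.
Unset Printing Implicit Defensive.
Import Order.TTheory GRing.Theory Num.Theory.
Import numFieldNormedType.Exports.
Local Open Scope classical_set_scope.
Local Open Scope ring_scope.

(* A finite or infinite strictly increasing sequence of positive integers
   beginning with 1 is identified with its set of terms, that is, with a set of
   positive integers containing 1. *)
Definition GG : set (set nat) :=
  [set S : set nat | S 1%N /\ forall n, S n -> (0 < n)%N].

(* For [N > 0] and a prime [p] dividing [N], [logn p N] is the exponent of [p]
   in the factorization of [N]. *)
Definition exponentially (S : set nat) : set nat :=
  [set N : nat | (0 < N)%N /\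
     forall p : nat, prime p -> (p %| N)%N -> S (logn p N)].

Definition upto {R : realType} (A : set nat) (x : R) : set nat :=
  [set i : nat | [/\ A i, (0 < i)%N & i%:R <= x]].

(* [fset_set] is only meaningful on finite sets. *)
Lemma finite_upto {R : realType} (A : set nat) (x : R) : finite_set (upto A x).
Proof.
apply: (@sub_finite_set _ _ `I_(Num.truncn x).+1) => [i [_ _ ix]|].
  rewrite /= ltnS truncn_ge_nat //.
  exact: le_trans (ler0n R i) ix.
exact: finite_II.
Qed.

(* A relation rather than a total limit, so that no default value arises when the
   limit does not exist; limits in [R] are unique. *)
Definition natural_density {R : realType} (A : set nat) (d : R) : Prop :=
  (#|` fset_set (upto A x)|%:R / x) @[x --> +oo] --> d.

(* Main.v *)
Require Import Defs.
From HB Require Import structures.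
From mathcomp Require Import all_boot all_order all_algebra.
From mathcomp Require Import finmap ring lra zify.
From mathcomp Require Import all_classical all_reals all_analysis.
Set Implicit Arguments.
Unset Strict Implicit.
Unset Printing Implicit Defensive.
Import Order.TTheory GRing.Theory Num.Theory.
Import numFieldNormedType.Exports.
Local Open Scope classical_set_scope.

(** Membership of [N] in [E(S)] depends only on the exponents of [N] that are at
least 2, and large squares rarely divide an integer: the number of [N <= n]
divisible by [d ^ 2] for some [d > K] is at most the sum of [n / d ^ 2] over
[d > K], hence at most [2 n / (2 K + 1)] ([cnt_square_divisor]).  This single
estimate serves twice.

Existence of the density.  Put [M = (K!) ^ (2 K)].  If no [d ^ 2] with [d > K]
divides [N], then [N] and [gcd (N, M)] are in [E(S)] together
([exponentially_gcd]).  So, up to a set of upper density [O(1 / K)], the set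
[E(S)] is periodic of period [M], and a set which is approximated by periodic
ones in this sense has a natural density ([density_of_periodic_approx]).

Strict monotonicity.  Let [S] be contained in [S'], and let [m] be in [S'] but
not in [S].  Then [E(S')] contains [E(S)] and also every [2 ^ m * s] with [s] odd
and divisible by no [d ^ 2], [d > 2]; these numbers are not in [E(S)].  The
estimate with [K = 2] removes at most [2/5] of all integers from the half that is
odd, so that the extra numbers have positive lower density and the densities
differ ([density_lt]).

Conclusion.  The sets of naturals contain a chain of the order type of the real
line, namely the Dedekind cuts of the rationals under an enumeration.  The
density is strictly increasing along this chain, which embeds the real line into
the set of densities. *)

(** * Counting integers up to a bound *)

Definition cnt (P : pred nat) (n : nat) : nat := count P (iota 1 n).

Lemma cntS (P : pred nat) n : cnt P n.+1 = cnt P n + P n.+1.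
Proof. by rewrite /cnt -[n.+1]addn1 iotaD count_cat /= addn0 add1n addn1. Qed.

Lemma cnt_le (P Q : pred nat) n :
  (forall i, 0 < i -> P i -> Q i) -> cnt P n <= cnt Q n.
Proof.
move=> PQ; elim: n => // n IH; rewrite !cntS leq_add //.
by case: (P _) (PQ n.+1) => // ->.
Qed.

Lemma cnt_leqn (P : pred nat) n : cnt P n <= n.
Proof. by rewrite /cnt (leq_trans (count_size _ _)) // size_iota. Qed.

Lemma cnt_or (P Q : pred nat) n : cnt (fun i => P i || Q i) n <= cnt P n + cnt Q n.
Proof. by rewrite /cnt -count_predUI leq_addr. Qed.

Lemma cnt_multiples d n : 0 < d -> cnt (dvdn d) n = n %/ d.
Proof.
by move=> d0; elim: n => [|n IH]; rewrite ?div0n // cntS IH divnS // addnC.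
Qed.

Lemma cnt_odd n : cnt odd n = uphalf n.
Proof.
elim: n => // n IH; rewrite cntS IH /= uphalf_half.
by case: odd; rewrite /= ?addn1 ?addn0 ?add0n.
Qed.

Lemma cnt_disjoint (P Q T : pred nat) n :
    (forall i, 0 < i -> P i -> T i) -> (forall i, 0 < i -> Q i -> T i) ->
    (forall i, 0 < i -> P i -> ~~ Q i) ->
  cnt P n + cnt Q n <= cnt T n.
Proof.
move=> PT QT PQ; elim: n => // n IH; rewrite !cntS addnACA leq_add //.
move: (PT n.+1 isT) (QT n.+1 isT) (PQ n.+1 isT).
by case: (P _) (Q _) (T _) => [] [] []; intuition.
Qed.

(** Multiplication by [k] embeds the integers up to [n / k] into those up to
[n]. *)
Lemma cnt_scale (P : pred nat) k n :
  0 < k -> cnt (fun i => P (k * i)) (n %/ k) <= cnt P n.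
Proof.
move=> k0; rewrite /cnt -(count_map (muln k) P) -!size_filter.
apply: uniq_leq_size => [|i].
  rewrite filter_uniq // map_inj_uniq ?iota_uniq // => x y /eqP.
  by rewrite eqn_pmul2l // => /eqP.
rewrite !mem_filter => /andP[-> /mapP[j]]; rewrite !mem_iota => /andP[j0 jn] ->.
by rewrite muln_gt0 k0 j0 add1n ltnS mulnC -leq_divRL.
Qed.

Definition periodic (P : pred nat) (p : nat) := forall i, P (p + i) = P i.

Lemma cnt_period (P : pred nat) p n :
  periodic P p -> cnt P (p + n) = cnt P p + cnt P n.
Proof.
move=> per; rewrite /cnt iotaD count_cat addnC [1 + p]addnC iotaDl count_map addnC.
by congr addn; apply: eq_count => i /=; exact: per.
Qed.

Lemma cnt_periodM (P : pred nat) p q r :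
  periodic P p -> cnt P (q * p + r) = q * cnt P p + cnt P r.
Proof.
by move=> per; elim: q => // q IH; rewrite !mulSn -!addnA cnt_period // IH.
Qed.

(** * Integers divisible by a large square *)

(** The bound [d <= n] makes the predicate decidable; it costs nothing when
[n > 0], see [has_square_divisorI]. *)
Definition has_square_divisor (K n : nat) : bool :=
  [exists d : 'I_n.+1, (K < d) && (d ^ 2 %| n)].

Lemma has_square_divisorI K n d :
  0 < n -> K < d -> d ^ 2 %| n -> has_square_divisor K n.
Proof.
move=> n0 Kd dn; have dn1 : d < n.+1.
  rewrite ltnS (leq_trans _ (dvdn_leq n0 dn)) // -[leqLHS]expn1 leq_pexp2l //.
  exact: leq_ltn_trans Kd.
by apply/existsP; exists (Ordinal dn1); rewrite /= Kd.
Qed.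

Lemma cnt_square_divisor_sum K n : K <= n ->
  cnt (has_square_divisor K) n <= \sum_(K.+1 <= d < n.+1) n %/ d ^ 2.
Proof.
move=> Kn.
have H : forall m, m <= n -> cnt (has_square_divisor K) m <=
   \sum_(K.+1 <= d < n.+1) cnt (dvdn (d ^ 2)) m.
  elim=> // m IH mn; rewrite cntS.
  under eq_bigr => d _ do rewrite cntS.
  rewrite big_split /= leq_add ?IH ?(ltnW mn) //.
  case E : has_square_divisor => //.
  have/existsP[d /andP[Kd dm]] := E.
  rewrite (bigD1_seq (nat_of_ord d)) ?iota_uniq ?dm //=.
  by rewrite mem_index_iota Kd (leq_trans (ltn_ord d)).
apply: leq_trans (H n (leqnn n)) _.
rewrite !big_nat leq_sum // => d /andP[Kd _]; rewrite cnt_multiples //.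
by rewrite expn_gt0 (leq_ltn_trans _ Kd).
Qed.

Section LargeSquares.
Variable R : realType.
Local Open Scope ring_scope.

(** The sum telescopes after the majoration
[1 / d ^ 2 <= 1 / (d ^ 2 - 1/4) = 2 / (2 d - 1) - 2 / (2 d + 1)].  The cruder
[1 / (d (d - 1))] would give [1 / K], which for [K = 2] is the whole density of
the odd numbers and would not suffice for [cnt_exponentially_gap]. *)
Lemma sum_inv_squares K n : (K <= n)%N ->
  \sum_(K.+1 <= d < n.+1) (d%:R ^+ 2)^-1 <= 2 / (2 * K%:R + 1) - 2 / (2 * n%:R + 1) :> R.
Proof.
elim: n => [|n IH].
  by rewrite leqn0 => /eqP ->; rewrite big_geq // subrr.
rewrite leq_eqVlt => /orP[/eqP ->|]; first by rewrite big_geq // subrr.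
rewrite ltnS => Kn; rewrite big_nat_recr //=.
apply: (le_trans (lerD (IH Kn) (lexx _))).
rewrite -addrA lerD2l -(natr1 n); set x : R := n%:R.
have x0 : 0 <= x by rewrite ler0n.
have -> : - (2 / (2 * (x + 1) + 1)) =
  - (2 / (2 * x + 1)) + 4 / ((2 * x + 1) * (2 * x + 3)).
  by field; rewrite !gt_eqF; lra.
rewrite lerD2l -[leLHS]mul1r ler_pdivrMr ?exprn_gt0 //; last lra.
rewrite mulrAC ler_pdivlMr; last by nra.
nra.
Qed.

Lemma cnt_square_divisor K n :
  (cnt (has_square_divisor K) n)%:R <= 2 / (2 * K%:R + 1) * n%:R :> R.
Proof.
have K0 : 0 < 2 * K%:R + 1 :> R by rewrite ltr_wpDl // mulr_ge0.
have [nK|Kn] := ltnP n K.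
  suff -> : cnt (has_square_divisor K) n = 0%N.
    by rewrite mulr_ge0 // divr_ge0 // ltW.
  have: (forall m, m <= n -> cnt (has_square_divisor K) m = 0)%N; last exact.
  elim=> // m IH mn; rewrite cntS IH 1?ltnW // add0n.
  case E: has_square_divisor => //.
  have/existsP[d /andP[Kd _]] := E.
  have := ltn_ord d; lia.
apply: (@le_trans _ _ (\sum_(K.+1 <= d < n.+1) (n%:R * (d%:R ^+ 2)^-1))).
  apply: (@le_trans _ _ (\sum_(K.+1 <= d < n.+1) (n %/ d ^ 2)%N)%:R).
    by rewrite ler_nat cnt_square_divisor_sum.
  rewrite natr_sum !big_nat ler_sum // => d /andP[Kd _].
  have d0 : (0 < d)%N by lia.
  rewrite ler_pdivlMr ?exprn_gt0 ?ltr0n // -natrX -natrM ler_nat.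
  exact: leq_divM.
rewrite -mulr_sumr mulrC ler_wpM2r // (le_trans (sum_inv_squares Kn)) //.
by rewrite gerBl divr_ge0 // addr_ge0 // mulr_ge0.
Qed.

End LargeSquares.

(** * Exponents of exponentially S-numbers *)

Lemma exponentiallyE (S : set nat) N : 0 < N ->
  exponentially S N <-> forall p, prime p -> logn p N = 0 \/ S (logn p N).
Proof.
move=> N0; split=> [[_ SN] p pp|SN].
  have [->|l0] := posnP (logn p N); first by left.
  by right; apply: SN => //; move: l0; rewrite logn_gt0 mem_primes => /and3P[].
split=> // p pp pN; have [l0|//] := SN p pp.
have : 0 < logn p N by rewrite logn_gt0 mem_primes pp N0.
by rewrite l0.
Qed.

(** If [p > K], the square is that of [p]; otherwise [p] divides [K!], so the
exponent of [p] in [K! ^ (2 K)], and a fortiori in [N], is at least [2 K], and the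
square is that of [p ^ K > K]. *)
Lemma large_logn_square_divisor K p N : prime p -> 0 < N ->
  1 < logn p N -> logn p (K`! ^ (2 * K)) < logn p N -> has_square_divisor K N.
Proof.
move=> pp N0 l1 lM; have [Kp|pK] := ltnP K p.
  by apply: (@has_square_divisorI _ _ p); rewrite // pfactor_dvdn.
have lK : 0 < logn p K`!.
  by rewrite logn_gt0 mem_primes pp fact_gt0 dvdn_fact // prime_gt0.
apply: (@has_square_divisorI _ _ (p ^ K)) => //; first exact/ltn_expl/prime_gt1.
rewrite -expnM pfactor_dvdn // mulnC ltnW // (leq_ltn_trans _ lM) //.
by rewrite lognX leq_pmulr.
Qed.

(** Passing to the gcd truncates the exponents of [N] at those of [K! ^ (2 K)].
Without large square divisors the only effect is to turn some exponents 1 into 0,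
and both are admissible since [1] is in [S]. *)
Lemma exponentially_gcd (S : set nat) K N : S 1 -> 0 < N ->
  `[< exponentially S N >] != `[< exponentially S (gcdn N (K`! ^ (2 * K))) >] ->
  has_square_divisor K N.
Proof.
move=> S1 N0; apply: contraR => nsq; apply/eqP/asbool_equiv_eq.
set M := K`! ^ (2 * K).
have M0 : 0 < M by rewrite expn_gt0 fact_gt0.
have g0 : 0 < gcdn N M by rewrite gcdn_gt0 N0.
have small p : prime p -> logn p N <= 1 \/ logn p N <= logn p M.
  move=> pp; have [|l1] := leqP (logn p N) 1; first by left.
  right; rewrite leqNgt; apply: contra nsq.
  exact: large_logn_square_divisor.
rewrite !exponentiallyE //; split=> H p pp; have := H p pp;
    rewrite logn_gcd //; have := small p pp.
- case=> [|/minn_idPl -> //].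
  case: (logn p N) => [_ _|[_ _|//]]; first by left; rewrite min0n.
  by case: (logn p M) => [|l]; [left|right; have/minn_idPl -> : 1 <= l.+1 by []].
- case=> [|/minn_idPl -> //].
  by case: (logn p N) => [_ _|[_ _|//]]; [left|right].
Qed.

(** The odd primes have exponent 0 or 1 in [s], so the prime 2 alone tells [S] and
[S'] apart. *)
Lemma exponentially_scale (S S' : set nat) m s :
    S' 1 -> S' m -> 0 < m -> ~ S m -> 0 < s -> odd s -> ~~ has_square_divisor 2 s ->
  exponentially S' (2 ^ m * s) /\ ~ exponentially S (2 ^ m * s).
Proof.
move=> S1 Sm m0 nSm s0 os nsq.
have N0 : 0 < 2 ^ m * s by rewrite muln_gt0 expn_gt0.
have l2 : logn 2 (2 ^ m * s) = m.
  rewrite lognM ?expn_gt0 // pfactorK // lognE s0 dvdn2 os /=.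
  by rewrite addn0.
rewrite !exponentiallyE //; split=> [p pp|/(_ 2 isT)]; last first.
  by rewrite l2 => -[m00|//]; rewrite m00 in m0.
have [->|p2] := eqVneq p 2; first by rewrite l2; right.
have -> : logn p (2 ^ m * s) = logn p s.
  by rewrite lognM ?expn_gt0 // lognX logn_prime // (negPf p2) muln0.
have : logn p s <= 1.
  rewrite leqNgt; apply: contra nsq => l1.
  apply: (@has_square_divisorI _ _ p) => //; last by rewrite pfactor_dvdn.
  by have := prime_gt1 pp; lia.
by case: (logn p s) => [|[|//]]; [left|right].
Qed.

(** * Existence of densities *)

Section Density.
Variable R : realType.
Local Open Scope ring_scope.


(** Writing [n = q p + r] with [r < p], the whole periods cancel, and what is left
is a difference of two numbers between [0] and [r]. *)
Lemma cnt_periodic (P : pred nat) p n : (0 < p)%N -> periodic P p ->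
  `|(cnt P n)%:R - (cnt P p)%:R / p%:R * n%:R| <= p%:R :> R.
Proof.
move=> p0 per; have p0R : 0 < p%:R :> R by rewrite ltr0n.
have -> : (cnt P n)%:R - (cnt P p)%:R / p%:R * n%:R =
   (cnt P (n %% p))%:R - (cnt P p)%:R / p%:R * (n %% p)%:R :> R.
  rewrite {1 2}(divn_eq n p) cnt_periodM // !natrD !natrM.
  by field; rewrite gt_eqF.
have b0 : 0 <= (cnt P p)%:R / p%:R :> R by rewrite divr_ge0.
have b1 : (cnt P p)%:R / p%:R <= 1 :> R.
  by rewrite ler_pdivrMr // mul1r ler_nat cnt_leqn.
have c0 : 0 <= (cnt P (n %% p))%:R :> R by [].
have cr : (cnt P (n %% p))%:R <= (n %% p)%:R :> R by rewrite ler_nat cnt_leqn.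
have rp : (n %% p)%:R <= p%:R :> R by rewrite ler_nat ltnW // ltn_pmod.
rewrite ler_norml; apply/andP; split; nra.
Qed.

Lemma card_upto (A : set nat) (x : R) : 0 <= x ->
  #|` fset_set (upto A x)| = cnt (fun i => `[< A i >]) (Num.truncn x).
Proof.
move=> x0; rewrite /cnt -size_filter.
rewrite -(undup_id (filter_uniq _ (iota_uniq _ _))) -card_fseq; congr (#|` _|).
apply/fsetP => i; rewrite in_fset_set; last exact: finite_upto.
rewrite !inE /= mem_filter mem_iota add1n ltnS truncn_ge_nat //.
apply/asboolP/andP => [[Ai -> ->]|[/asboolP Ai /andP[]]]; last by split.
by split=> //; exact/asboolP.
Qed.

Lemma cnt_symdiff (P Q B : pred nat) n :
  (forall i, (0 < i)%N -> P i != Q i -> B i) ->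
  `|(cnt P n)%:R - (cnt Q n)%:R| <= (cnt B n)%:R :> R.
Proof.
move=> PQ; have aux (P' Q' : pred nat) : (forall i, (0 < i)%N -> P' i != Q' i -> B i) ->
    (cnt P' n)%:R <= (cnt Q' n)%:R + (cnt B n)%:R :> R.
  move=> H; rewrite -natrD ler_nat; apply: leq_trans (cnt_or _ _ _).
  apply: cnt_le => i i0 Pi; case: (boolP (Q' i)) => //= nQ.
  by apply: H; rewrite // Pi (negPf nQ).
have := aux P Q PQ; have := aux Q P; rewrite ler_norml => H1 H2.
have {}H1 := H1 _; rewrite lerBlDl H2 andbT lerBrDl lerBlDr; apply: H1 => i i0.
by rewrite eq_sym; exact: PQ.
Qed.

(** The averages of [A] form a Cauchy filter: for large [x] they stay within
[e + (p + 1) / x] of the density [cnt P p / p] of the periodic set [P]. *)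
Lemma density_of_periodic_approx (A : set nat) :
  (forall e : R, 0 < e -> exists (P B : pred nat) (p : nat),
     [/\ (0 < p)%N, periodic P p,
         forall i, (0 < i)%N -> `[< A i >] != P i -> B i &
         forall n, (cnt B n)%:R <= e * n%:R]) ->
  exists d : R, natural_density A d.
Proof.
move=> H; suff: cvg ((#|` fset_set (upto A x)|%:R / x : R) @[x --> +oo%R]).
  by move=> c; exists (lim ((#|` fset_set (upto A x)|%:R / x : R) @[x --> +oo%R])).
apply: cauchy_cvg; apply: cauchy_exP => e e0.
have e20 : 0 < e / 2 by rewrite divr_gt0.
have [P [B [p [p0 per PB Be]]]] := H _ e20.
exists ((cnt P p)%:R / p%:R).
rewrite nbhs_filterE fmapE -ball_normE; near=> x => /=.
have x0 : 0 < x by near: x; apply: nbhs_pinfty_gt; exact: num_real.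
have xp : (p%:R + 1) / (e / 2) < x by near: x; apply: nbhs_pinfty_gt; exact: num_real.
rewrite card_upto ?ltW //.
have /andP[nx xn] := truncn_itv (ltW x0).
rewrite ltr_pdivrMr // in xp.
have := cnt_symdiff (Num.truncn x) PB; have := Be (Num.truncn x).
have := cnt_periodic (Num.truncn x) p0 per.
rewrite -natr1 in xn.
have b0 : 0 <= (cnt P p)%:R / p%:R :> R by rewrite divr_ge0.
have b1 : (cnt P p)%:R / p%:R <= 1 :> R.
  by rewrite ler_pdivrMr ?ltr0n // mul1r ler_nat cnt_leqn.
set n : R := (Num.truncn x)%:R in nx xn *.
set b := (cnt P p)%:R / p%:R in b0 b1 *.
move=> H1 H2 H3.
(* Multiply by [x]: all the data are then linear in [x] and [n = floor x]. *)
rewrite -(ltr_pM2r x0) -[X in _ * X < _](gtr0_norm x0) -normrM mulrBl divfK ?gt_eqF //.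
move: H1 H3; rewrite !ler_norml ltr_norml => /andP[H1 H1'] /andP[H3 H3'].
have : e / 2 * n <= e / 2 * x by rewrite ler_pM2l.
have : 0 <= b * (x - n) <= 1 by apply/andP; split; nra.
move: H2; set a := e / 2 * n; have -> : e * x = 2 * (x * (e / 2)) by field.
rewrite (mulrC _ x) mulrBr => H2 /andP[? ?] ?; apply/andP; split; lra.
Unshelve. all: by end_near.
Qed.

Lemma density_exists (S : set nat) : S 1%N ->
  exists d : R, natural_density (exponentially S) d.
Proof.
move=> S1; apply: density_of_periodic_approx => e e0.
pose K := (Num.truncn e^-1).+1.
exists (fun i => `[< exponentially S (gcdn i (K`! ^ (2 * K))) >]),
  (has_square_divisor K), (K`! ^ (2 * K))%N; split.
- by rewrite expn_gt0 fact_gt0.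
- by move=> i; rewrite gcdnC gcdnDl gcdnC.
- by move=> i; exact: exponentially_gcd.
move=> n; apply: (le_trans (cnt_square_divisor R K n)); rewrite ler_wpM2r //.
have Ke : e^-1 < K%:R by have /truncn_itv/andP[] : 0 <= e^-1 by rewrite invr_ge0 ltW.
have K0 : 0 < K%:R :> R by rewrite ltr0n.
rewrite ler_pdivrMr; last lra.
have : 1 <= e * K%:R by rewrite -ler_pdivrMl // mulr1 ltW.
move: (K%:R) K0 => k; nra.
Qed.

(** * Strict monotonicity in S *)

(** The constant: with [k = n / 2 ^ m], at least [k / 2] of the [s <= k] are odd,
and at most [2 k / 5] are divisible by some [d ^ 2] with [d > 2]. *)
Lemma cnt_exponentially_gap (S S' : set nat) m n :
    S `<=` S' -> S' 1%N -> S' m -> (0 < m)%N -> ~ S m ->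
  (cnt (fun i => `[< exponentially S i >]) n)%:R + (n %/ 2 ^ m)%N%:R / 10 <=
  (cnt (fun i => `[< exponentially S' i >]) n)%:R :> R.
Proof.
move=> SS S1 Sm m0 nSm; set k := (n %/ 2 ^ m)%N.
pose D i := `[< exponentially S' i >] && ~~ `[< exponentially S i >].
pose G s := odd s && ~~ has_square_divisor 2 s.
have H1 : (cnt (fun i => `[< exponentially S i >]) n + cnt G k <=
           cnt (fun i => `[< exponentially S' i >]) n)%N.
  apply: (@leq_trans (cnt (fun i => `[< exponentially S i >]) n + cnt D n)).
    rewrite leq_add2l (leq_trans _ (cnt_scale D n (_ : 0 < 2 ^ m)%N)) ?expn_gt0 //.
    apply: cnt_le => s s0 /andP[os nsq].
    have [? ?] := exponentially_scale S1 Sm m0 nSm s0 os nsq.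
    by apply/andP; split; [exact/asboolP|apply/asboolP].
  apply: cnt_disjoint => i i0; last by move=> Si; rewrite /D Si andbF.
    move=> /asboolP[_ Si]; apply/asboolP; split=> // p pp pi.
    by apply: SS; exact: Si.
  by case/andP.
have H2 : (cnt odd k <= cnt G k + cnt (has_square_divisor 2) k)%N.
  apply: leq_trans (cnt_or _ _ _); apply: cnt_le => i _ oi.
  by rewrite /G oi; case: has_square_divisor.
have H3 : (k <= 2 * cnt odd k)%N.
  by rewrite cnt_odd uphalf_half; have := odd_double_half k; lia.
have H4 := cnt_square_divisor R 2 k.
move: H1; rewrite -(ler_nat R) natrD => H1.
move: H2; rewrite -(ler_nat R) natrD => H2.
move: H3; rewrite -(ler_nat R) natrM => H3.
have e5 : 2 / (2 * 2%:R + 1) = 2 / 5 :> R by congr (_ / _); ring.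
rewrite e5 in H4.
lra.
Qed.

Lemma density_lt (S S' : set nat) m (d d' : R) :
    S `<=` S' -> S' 1%N -> S' m -> (0 < m)%N -> ~ S m ->
    natural_density (exponentially S) d -> natural_density (exponentially S') d' ->
  d < d'.
Proof.
move=> SS S1 Sm m0 nSm dS dS'; pose k : R := (2 ^ m)%N%:R.
have k0 : 1 <= k by rewrite ler1n expn_gt0.
(* The gap gives [1 / (10 k)] in the limit; half of it absorbs the rounding of
   [x] and of [n / 2 ^ m] as soon as [x > 4 k]. *)
pose c := (20 * k)^-1; have c0 : 0 < c by rewrite invr_gt0; lra.
suff : d + c <= d' by apply: lt_le_trans; rewrite ltrDl.
apply: ler_cvg_to (cvgD dS (cvg_cst c)) dS' _.
near=> x.
have xk : 4 * k < x by near: x; apply: nbhs_pinfty_gt; exact: num_real.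
have x0 : 0 < x by lra.
suff : #|` fset_set (upto (exponentially S) x)|%:R / x + c <=
       #|` fset_set (upto (exponentially S') x)|%:R / x by [].
rewrite !card_upto ?(ltW x0) //.
have /andP[_ xn] := truncn_itv (ltW x0).
rewrite ler_pdivlMr // mulrDl divfK ?gt_eqF //.
apply: le_trans (cnt_exponentially_gap (Num.truncn x) SS S1 Sm m0 nSm).
rewrite lerD2l.
have nk : (Num.truncn x)%:R + 1 <= ((Num.truncn x %/ 2 ^ m)%N%:R + 1) * k.
  by rewrite /k !natr1 -natrM ler_nat ltn_ceil // expn_gt0.
rewrite -natr1 in xn.
rewrite /c mulrC ler_pdivrMr; last lra.
lra.
Unshelve. all: by end_near.
Qed.

(** * A chain of sets ordered like the real line *)

(** The shift by 2 reserves the value 1, which belongs to every set, and leaves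
out 0. *)
Definition rational_cut (r : R) : set nat :=
  [set n | n = 1%N \/ exists2 q : rat, ratr q < r & n = (choice.pickle q).+2].

Lemma rational_cut_GG r : GG (rational_cut r).
Proof. by split=> [|n [->//|[q _ ->]]]; first by left. Qed.

Lemma rational_cut_density_lt (r r' d d' : R) : r < r' ->
    natural_density (exponentially (rational_cut r)) d ->
    natural_density (exponentially (rational_cut r')) d' ->
  d < d'.
Proof.
move=> rr'; have [q] := rat_in_itvoo rr'; rewrite in_itv /= => /andP[rq qr'].
apply: (@density_lt _ _ (choice.pickle q).+2) => //.
- move=> n [->|[a ar ->]]; first by left.
  by right; exists a => //; exact: lt_trans rr'.
- by left.
- by right; exists q.
- case=> // -[a ar [/(pcan_inj choice.pickleK) qa]].
  by move: ar; rewrite -qa ltNge (ltW rq).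
Qed.

(** A countable set of reals is Lebesgue negligible, and the unit interval is
not. *)
Lemma uncountable_setT : ~ countable [set: R].
Proof.
move=> cR; have : lebesgue_measure (`[0, 1]%classic : set R) = 0%E.
  exact/countable_lebesgue_measure0/(sub_countable _ cR)/subset_card_le.
rewrite lebesgue_measure_itv /= lte_fin ltr01 oppr0 adde0 => /eqP.
by rewrite eqe oner_eq0.
Qed.

End Density.

Theorem theorem2 (R : realType) :
  ~ countable [set d : R | exists2 S : set nat,
                             GG S & natural_density (exponentially S) d].
Proof.
move=> cD; apply: (@uncountable_setT R).
have /choice[h hP] : forall r : R, exists d : R,
    natural_density (exponentially (rational_cut r)) d.
  by move=> r; apply: density_exists; left.
have h_inj : injective h.
  move=> r r' hrr'; apply/eqP; case: ltgtP => // rr'.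
    by have := rational_cut_density_lt rr' (hP r) (hP r'); rewrite hrr' ltxx.
  by have := rational_cut_density_lt rr' (hP r') (hP r); rewrite hrr' ltxx.
have [f f_inj] := countable_injP _ cD.
apply/countable_injP; exists (f \o h) => r r' _ _ /= fh; apply: h_inj.
by apply: f_inj fh; rewrite inE /=; [exists (rational_cut r)|exists (rational_cut r')];
  rewrite ?hP //; exact: rational_cut_GG.
Qed.
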